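(* Let $Z$ be a $JC^*$-triple system of rank $\geq 2$ which is isomorphic to a finite-dimensional Cartan factor of type I, and let $\{u_{ij}:1\leq i\leq n,\ 1\leq j\leq m\}$ be a rectangular grid spanning $Z$ (so $Z$ is $JB^*$-triple isomorphic to $\mathbb{M}_{n,m}$ with $\min(n,m)\ge2$). Then $T^*(Z)$ is TRO-isomorphic to $\mathbb{M}_{n,m}\oplus\mathbb{M}_{m,n}$.
   Context: $\mathbb{M}_{n,m}$ denotes the complex $n\times m$-matrices. A $JC^*$-triple system is a closed subspace of a $C^*$-algebra invariant under $\{a,b,c\}=\frac12(ab^*c+cb^*a)$; a $JB^*$-triple homomorphism (isomorphism) is a linear (bijective) map preserving the triple product. A finite-dimensional Cartan factor of type I is a triple system $JB^*$-triple isomorphic to some $\mathbb{M}_{n,m}$ with product $\frac12(ab^*c+cb^*a)$; its rank is $\min(n,m)$. A tripotent is an element $e$ with $\{e,e,e\}=e$; it is minimal if $\{e,Z,e\}=\mathbb{C}e$. A rectangular grid is a family $\{u_{ij}:i\in\Delta,j\in\Sigma\}$ of non-zero minimal tripotents such that (RG1) $\{u_{il},u_{il},u_{jk}\}=0$ if $i\neq j$, $k\neq l$. (RG2) $\{u_{il},u_{il},u_{jk}\}=\frac12u_{jk}$ and $\{u_{jk},u_{jk},u_{il}\}=\frac12u_{il}$ if either $j=i,k\neq l$ or $j\neq i,k=l$. (RG3) $\{u_{jk},u_{jl},u_{il}\}=\frac12u_{ik}$ if $j\neq i$ and $k\neq l$. (RG4) All other triple products in the grid (apart from $\{u_{ij},u_{ij},u_{ij}\}=u_{ij}$)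 equal $0$. A TRO is a closed subspace $T\subseteq B(H)$, $H$ a Hilbert space, with $xy^*z\in T$ for all $x,y,z\in T$; it carries the triple product $\frac12(xy^*z+zy^*x)$. TRO-homomorphisms are linear maps preserving $xy^*z$. The universal enveloping TRO of $Z$ is the TRO $T^*(Z)$, unique up to TRO-isomorphism, with a $JB^*$-triple homomorphism $\rho_Z:Z\to T^*(Z)$ such that $\rho_Z(Z)$ generates $T^*(Z)$ as a TRO and every $JB^*$-triple homomorphism $\alpha:Z\to T$ into a TRO $T$ factors as $\alpha=T^*(\alpha)\circ\rho_Z$ with $T^*(\alpha):T^*(Z)\to T$ a TRO-homomorphism. *)

(* Defs.v *)
(* The complex numbers are [R[i]], for [R : realType]. *)
From HB Require Import structures.
From mathcomp Require Import all_boot all_order all_algebra.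
From mathcomp Require Import complex.
From mathcomp Require Import all_classical all_reals.
From mathcomp Require Import topology normedtype.

Set Implicit Arguments.
Unset Strict Implicit.
Unset Printing Implicit Defensive.

Import Order.TTheory GRing.Theory Num.Theory.
Import numFieldNormedType.Exports.

Local Open Scope classical_set_scope.
Local Open Scope ring_scope.
Local Open Scope complex_scope.

(* Not necessarily unital; the norm takes its values in R[i], where
   comparison with 0 includes being real. *)
Record cstarAlgebra (R : realType) := CstarAlgebra {
  cstar_space :> completeNormedModType R[i];
  cstar_mul : {bilinear cstar_space -> cstar_space -> cstar_space};
  cstar_adj : cstar_space -> cstar_space;
  cstar_mulA : associative cstar_mul;
  cstar_normM : forall a b, `|cstar_mul a b| <= `|a| * `|b|;
  cstar_adjK : involutive cstar_adj;
  cstar_adj_semilinear : forall (l : R[i]) a b,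
    cstar_adj (l *: a + b) = Num.conj l *: cstar_adj a + cstar_adj b;
  cstar_adjM : forall a b,
    cstar_adj (cstar_mul a b) = cstar_mul (cstar_adj b) (cstar_adj a);
  cstar_norm_adj : forall a, `|cstar_mul (cstar_adj a) a| = `|a| ^+ 2 }.

(* The inner product is linear in its first argument. *)
Record hilbertSpace (R : realType) := HilbertSpace {
  hilbert_space :> completeNormedModType R[i];
  hilbert_dot : {dot hilbert_space for Num.conj};
  hilbert_normE : forall x : hilbert_space, `|x| ^+ 2 = hilbert_dot x x }.

Section BoundedOperators.
Context {R : realType} {H : hilbertSpace R}.

Definition bounded_operator (f : H -> H) : Prop :=
  linear f /\ exists M : R[i], forall x, `|f x| <= M * `|x|.

(* For a bounded operator the Riesz representation theorem provides exactly one
   such g, so that the default value 0 is never used. *)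
Definition adjoint (f : H -> H) : H -> H :=
  xget 0 [set g : H -> H |
    forall x y, hilbert_dot H (f x) y = hilbert_dot H x (g y)].

(* Closedness in B(H) for the operator norm: for e > 0, the bound
   |f x - g x| <= e |x| for all x means that f - g has norm at most e. *)
Definition opnorm_closed (T : set (H -> H)) : Prop :=
  forall f, bounded_operator f ->
    (forall e : R[i], 0 < e ->
       exists2 g, T g & forall x, `|f x - g x| <= e * `|x|) ->
    T f.

End BoundedOperators.

Section TernaryProducts.
Context {R : realType}.

Definition cstar_triple {A : cstarAlgebra R} (a b c : A) : A :=
  cstar_mul A (cstar_mul A a (cstar_adj b)) c.

Definition op_triple {H : hilbertSpace R} (f g h : H -> H) : H -> H :=
  f \o adjoint g \o h.

Definition mx_triple {n m : nat} (x y z : 'M[R[i]]_(n, m)) : 'M[R[i]]_(n, m) :=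
  x *m map_mx Num.conj y^T *m z.

(* M_{n,m} (+) M_{m,n} *)
Definition mx2_triple {n m : nat} (x y z : 'M[R[i]]_(n, m) * 'M[R[i]]_(m, n)) :
    'M[R[i]]_(n, m) * 'M[R[i]]_(m, n) :=
  (mx_triple x.1 y.1 z.1, mx_triple x.2 y.2 z.2).

Definition jordan {V : lmodType R[i]} (p : V -> V -> V -> V) (x y z : V) : V :=
  2^-1 *: (p x y z + p z y x).

End TernaryProducts.

Section Subspaces.
Context {R : realType}.

Definition subspace {V : lmodType R[i]} (D : set V) : Prop :=
  D 0 /\ forall (l : R[i]) x y, D x -> D y -> D (l *: x + y).

Definition triple_closed {V : lmodType R[i]} (p : V -> V -> V -> V)
    (D : set V) : Prop :=
  forall x y z, D x -> D y -> D z -> D (p x y z).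

(* Linear maps D -> E preserving the ternary products p and q; only the values
   of f on D matter. *)
Definition triple_hom {V W : lmodType R[i]}
    (p : V -> V -> V -> V) (D : set V) (q : W -> W -> W -> W) (E : set W)
    (f : V -> W) : Prop :=
  [/\ set_fun D E f,
      forall (l : R[i]) x y, D x -> D y -> f (l *: x + y) = l *: f x + f y
    & forall x y z, D x -> D y -> D z -> f (p x y z) = q (f x) (f y) (f z)].

Definition triple_isomorphic {V W : lmodType R[i]}
    (p : V -> V -> V -> V) (D : set V) (q : W -> W -> W -> W) (E : set W) :
    Prop :=
  exists2 f : V -> W, triple_hom p D q E f & set_bij D E f.

End Subspaces.

Section JCstar.
Context {R : realType} {A : cstarAlgebra R}.

Definition is_JCstar (Z : set A) : Prop :=
  [/\ subspace Z, closed Z & triple_closed (jordan cstar_triple) Z].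

(* Z is isomorphic to a finite-dimensional Cartan factor of type I and has
   rank r. *)
Definition type_I_of_rank (Z : set A) (r : nat) : Prop :=
  exists n m : nat, r = minn n m /\
    triple_isomorphic (jordan cstar_triple) Z
      (jordan mx_triple) [set: 'M[R[i]]_(n, m)].

Definition tripotent (e : A) : Prop := jordan cstar_triple e e e = e.

Definition minimal_tripotent (Z : set A) (e : A) : Prop :=
  [/\ Z e, tripotent e &
      [set jordan cstar_triple e z e | z in Z] = [set l *: e | l in [set: R[i]]]].

(* The index patterns of the products {u_a, u_b, u_c} mentioned in RG1, RG2,
   RG3 and in {u_a, u_a, u_a} = u_a: the case a = b covers the last one (a = c)
   as well as RG1 and RG2 (a and c differ in both components or in exactly
   one); the other case is RG3, with a = (j, k), b = (j, l), c = (i, l). *)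
Definition grid_listed (I J : Type) (a b c : I * J) : Prop :=
  a = b \/ [/\ a.1 = b.1, b.2 = c.2, a.1 <> c.1 & a.2 <> b.2].

(* The triple product is symmetric in its outer arguments, so in RG4 a product
   is "other" if neither {a, b, c} nor {c, b, a} is listed. *)
Record rectangular_grid (Z : set A) (I J : Type) (u : I -> J -> A) : Prop := {
  grid_minimal : forall i j, u i j <> 0 /\ minimal_tripotent Z (u i j);
  grid_RG1 : forall i j k l, i <> j -> k <> l ->
    jordan cstar_triple (u i l) (u i l) (u j k) = 0;
  grid_RG2 : forall i j k l, (j = i /\ k <> l) \/ (j <> i /\ k = l) ->
    jordan cstar_triple (u i l) (u i l) (u j k) = 2^-1 *: u j k /\
    jordan cstar_triple (u j k) (u j k) (u i l) = 2^-1 *: u i l;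
  grid_RG3 : forall i j k l, j <> i -> k <> l ->
    jordan cstar_triple (u j k) (u j l) (u i l) = 2^-1 *: u i k;
  grid_RG4 : forall a b c : I * J,
    ~ grid_listed a b c -> ~ grid_listed c b a ->
    jordan cstar_triple (u a.1 a.2) (u b.1 b.2) (u c.1 c.2) = 0 }.

Definition grid_spans (Z : set A) (n m : nat) (u : 'I_n -> 'I_m -> A) : Prop :=
  Z = [set \sum_(i < n) \sum_(j < m) c i j *: u i j
      | c in [set: 'I_n -> 'I_m -> R[i]]].

End JCstar.

Section TRO.
Context {R : realType}.

Definition is_TRO {H : hilbertSpace R} (T : set (H -> H)) : Prop :=
  [/\ T `<=` bounded_operator, subspace T, opnorm_closed T
    & triple_closed op_triple T].

Definition TRO_generated_by {H : hilbertSpace R} (S : set (H -> H)) :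
    set (H -> H) :=
  smallest is_TRO S.

Record is_universal_TRO {A : cstarAlgebra R} (Z : set A)
    {H : hilbertSpace R} (T : set (H -> H)) (rho : A -> (H -> H)) : Prop := {
  universal_TRO : is_TRO T;
  universal_hom :
    triple_hom (jordan cstar_triple) Z (jordan op_triple) T rho;
  universal_generated : T = TRO_generated_by (rho @` Z);
  universal_factor :
    forall (K : hilbertSpace R) (S : set (K -> K)) (alpha : A -> (K -> K)),
      is_TRO S ->
      triple_hom (jordan cstar_triple) Z (jordan op_triple) S alpha ->
      exists2 phi : (H -> H) -> (K -> K),
        triple_hom op_triple T op_triple S phi &
        forall z, Z z -> alpha z = phi (rho z) }.

End TRO.

(* Main.v *)
Require Import Defs.
From HB Require Import structures.
From mathcomp Require Import all_boot all_order all_algebra.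
From mathcomp Require Import complex ring.
From mathcomp Require Import all_classical all_reals.
From mathcomp Require Import topology normedtype.

Set Implicit Arguments.
Unset Strict Implicit.
Unset Printing Implicit Defensive.

Import Order.TTheory GRing.Theory Num.Theory.
Import numFieldNormedType.Exports.

Local Open Scope classical_set_scope.
Local Open Scope ring_scope.
Local Open Scope complex_scope.

(** Let e_ij = rho(u_ij).  The Jordan grid relations force e_ij e_kl^* = 0 and
    e_ij^* e_kl = 0 for i <> k, j <> l, and make e_ij e_kj^* (i <> k)
    independent of j, with the same statement for the grids obtained by taking
    adjoints or by exchanging the two indices.  Hence
    a_ij = e_ij' e_i'j'^* e_i'j and b_ij = e_i'j e_i'j'^* e_ij' do not depend on
    i' <> i and j' <> j; moreover e_ij = a_ij + b_ij, the a_ij multiply like the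
    matrix units of M_{n,m}, the b_ij like those of M_{m,n}, and a b^* = 0,
    a^* b = 0.  The span of all these elements is a TRO, being closed because its
    coordinates are given by vector functionals, so it equals T.  No a_ij or
    b_ij vanishes: factor the two Jordan homomorphisms x |-> x and x |-> x^T
    into matrices, acting on finite-dimensional l2, through T.  No Riesz
    representation theorem is needed: a grid element satisfies e = e e^* e, so
    that either its adjoint exists or e = 0.  Finally n, m >= 2, since otherwise
    {x,x,x} would be a multiple of x for all x in Z. *)

(** * Jordan grids in a ring with involution *)

Definition involution (B : pzRingType) (star : B -> B) : Prop :=
  [/\ involutive star, {morph star : x y / x + y}
    & forall x y, star (x * y) = star y * star x].

(** These are the relations of matrix units for twice the Jordan product: one formula covers RG1 to
    RG4 and avoids dividing by 2 in the ring. *)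
Definition jordan_grid (B : pzRingType) (star : B -> B) (I J : eqType)
    (e : I -> J -> B) : Prop :=
  forall i j k l p q,
    e i j * star (e k l) * e p q + e p q * star (e k l) * e i j =
    e i q *+ ((j == l) && (k == p)) + e p j *+ ((i == k) && (l == q)).

(** * Symmetries of grids: exchanging indices and taking adjoints *)

Section GridDuality.
Variables (B : pzRingType) (star : B -> B) (star_inv : involution star).
Variables (I J : eqType) (e : I -> J -> B) (eG : jordan_grid star e).

Lemma jordan_grid_tr : jordan_grid star (fun j i => e i j).
Proof.
move=> j i l k q p; rewrite eG addrC; congr (_ *+ _ + _ *+ _); by rewrite andbC.
Qed.

Lemma jordan_grid_star : jordan_grid star (fun i j => star (e i j)).
Proof.
case: star_inv => sK sD sM i j k l p q.
have sMn x (b : bool) : star (x *+ b) = star x *+ b.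
  case: b => //=; rewrite !mulr0n; apply: (addrI (star 0)).
  by rewrite -sD !addr0.
have := congr1 star (eG i j k l p q); rewrite !sD !sM !sMn !mulrA addrC.
by rewrite !sK.
Qed.

End GridDuality.

(** * Orthogonality and exchange relations in a grid *)

Section Grid.
Variables (B : pzRingType) (star : B -> B) (star_inv : involution star).
Hypothesis mul2I : forall x : B, x + x = 0 -> x = 0.

Lemma starK : involutive star. Proof. by case: star_inv. Qed.
Lemma starD : {morph star : x y / x + y}. Proof. by case: star_inv. Qed.
Lemma starM x y : star (x * y) = star y * star x.
Proof. by case: star_inv. Qed.
Lemma star0 : star 0 = 0.
Proof. by apply: (addrI (star 0)); rewrite -starD !addr0. Qed.

Section Orthogonality.
Variables (I J : eqType) (e : I -> J -> B) (eG : jordan_grid star e).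

Lemma grid_tripotent i j : e i j * star (e i j) * e i j = e i j.
Proof.
apply/subr0_eq/mul2I; have := eG i j i j i j; rewrite !eqxx /= !mulr1n => h.
by rewrite addrACA -opprD h subrr.
Qed.

Lemma grid_star_tripotent i j :
  star (e i j) * e i j * star (e i j) = star (e i j).
Proof. by rewrite -[in RHS]grid_tripotent !starM starK mulrA. Qed.

(** With p = [a * star a] and q = [star a * a], the relation p b + b q = 0, multiplied by p on the
    left and by q on the right, gives p b = - p b q = b q. Hence 2 p b = 0, and [star a] absorbs
    p. *)
Lemma grid_ortho i j k l : i != k -> j != l -> star (e i j) * e k l = 0.
Proof.
move=> ik jl; set a := e i j; set b := e k l.
have h : a * star a * b + b * star a * a = 0.
  have := eG i j i j k l.
  by rewrite !eqxx (negPf ik) (negPf jl) andbF addr0 => ->.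
have aaa : a * star a * a = a := grid_tripotent i j.
have saa : star a * a * star a = star a := grid_star_tripotent i j.
have h1 : a * star a * b + a * star a * b * star a * a = 0.
  have := congr1 (fun x => a * (star a * x)) h.
  by rewrite !mulr0 !mulrDr !mulrA aaa.
have h2 : a * star a * b * star a * a + b * star a * a = 0.
  have := congr1 (fun x => x * star a * a) h.
  by rewrite !mul0r !mulrDl -(mulrA (b * star a * a)) -(mulrA (b * _)) (mulrA a) aaa.
have h3 : a * star a * b = b * star a * a.
  by apply: (addIr (a * star a * b * star a * a)); rewrite h1 addrC h2.
have h4 : a * star a * b = 0 by apply: mul2I; rewrite {2}h3.
by rewrite -saa -!mulrA (mulrA a) h4 mulr0.
Qed.

End Orthogonality.

Section Exchange.
Variables (I J : eqType) (e : I -> J -> B) (eG : jordan_grid star e).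

Lemma grid_ortho_star i j k l : i != k -> j != l -> e i j * star (e k l) = 0.
Proof.
move=> ik jl; have := grid_ortho (jordan_grid_star star_inv eG) ik jl.
by rewrite starK.
Qed.

(** Expand e_ij by RG3 through e_il, e_kl, e_kj and multiply by e_kj^*. The terms containing e_il
    e_kj^* vanish, and RG2 for e_kj, e_kl reduces the remaining one to e_il e_kl^*. *)
Lemma grid_exchange i k j l : i != k ->
  e i j * star (e k j) = e i l * star (e k l).
Proof.
move=> ik; have [-> //|jl] := eqVneq j l.
have h : e i j = e i l * star (e k l) * e k j + e k j * star (e k l) * e i l.
  have := eG i l k l k j.
  by rewrite !eqxx /= (negPf ik) /= mulr0n addr0 mulr1n.
have h2 : star (e k l) * e k j * star (e k j) +
    star (e k j) * e k j * star (e k l) = star (e k l).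
  have := eG k j k j k l; rewrite !eqxx (negPf jl) andbT /= addr0 mulr1n.
  by move/(congr1 star); rewrite starD !starM !starK !mulrA.
have z : e i l * star (e k j) = 0 by rewrite (grid_ortho_star ik) // eq_sym.
rewrite {1}h mulrDl -(mulrA _ (e i l)) z mulr0 addr0 -{2}h2 mulrDr !mulrA z.
by rewrite !mul0r addr0.
Qed.

End Exchange.

(** The type ['I_k.+2] guarantees a second index; the value is 0, or 1 if [i] is 0. *)
Definition other k (i : 'I_k.+2) : 'I_k.+2 := lift i ord0.

Lemma otherP k (i : 'I_k.+2) : (i != other i) * (other i != i).
Proof. by rewrite [other i == i]eq_sym neq_lift. Qed.

Lemma exists_other k (i : 'I_k.+2) : exists j, j != i.
Proof. by exists (other i); rewrite otherP. Qed.

(* For e_ij = (E_ij, E_ji) this is (E_ij, 0). *)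
Definition grid_part (n m : nat) (e : 'I_n.+2 -> 'I_m.+2 -> B) i j : B :=
  e i (other j) * star (e (other i) (other j)) * e (other i) j.

(** * The first part of a grid element *)

Section Part.
Variables (n m : nat) (e : 'I_n.+2 -> 'I_m.+2 -> B).
Hypothesis eG : jordan_grid star e.

Lemma grid_exchange_star i k j l : j != l ->
  star (e i j) * e i l = star (e k j) * e k l.
Proof.
move=> ik.
have := grid_exchange (jordan_grid_star star_inv (jordan_grid_tr eG)) i k ik.
by rewrite !starK.
Qed.

(** If [k != i], change the row in the last two factors, which is possible since [other j != j], and
    then the column in the first two. If [l != j], proceed in the opposite order. So one of the new
    indices may coincide with the old one. *)
Lemma grid_partE i j k l : (k != i) || (l != j) ->
  grid_part e i j = e i l * star (e k l) * e k j.
Proof.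
case/orP=> [ki|lj]; rewrite /grid_part.
  rewrite -mulrA (grid_exchange_star (other i) k) ?otherP //.
  by rewrite mulrA (grid_exchange eG _ l) // eq_sym.
rewrite (grid_exchange eG (other j) l) ?otherP // -mulrA.
by rewrite (grid_exchange_star (other i) k) // mulrA.
Qed.

(** In the model e_ij = (E_ij, E_ji) the factor e_ij^* e_il is (E_jl, 0): it moves column j to
    column l and annihilates the second summand. *)
Lemma grid_part_rmul i j l : l != j ->
  grid_part e i j * (star (e i j) * e i l) = grid_part e i l.
Proof.
move=> lj; have [k ki] := exists_other i.
rewrite (@grid_partE i j k j) ?ki // (@grid_partE i l k j) ?ki //.
rewrite (grid_exchange_star i k) 1?eq_sym // -!mulrA.
by rewrite (mulrA (star _) (e k j)) (mulrA (_ * _)) grid_star_tripotent.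
Qed.

End Part.

(** * Splitting a grid into two orthogonal systems of matrix units *)

Section TwoParts.
Variables (n m : nat) (e : 'I_n.+2 -> 'I_m.+2 -> B).
Hypothesis eG : jordan_grid star e.

Notation a := (grid_part e).
Notation b := (fun i j => grid_part (fun j i => e i j) j i).

(** This is RG3 for the three grid elements in the definition of [a i j]; the reversed product is
    [b i j]. *)
Lemma grid_split i j : e i j = a i j + b i j.
Proof.
by rewrite /grid_part eG !eqxx (negPf (otherP i).1) addr0.
Qed.

Let partE := grid_partE eG.
Let part_trE := grid_partE (jordan_grid_tr eG).

(** The auxiliary indices are chosen crosswise, so that the adjacent factors e_tj and e_kp^* have t
    != k and p != j and are orthogonal. *)
Lemma grid_part_star_tr i j k l : a i j * star (b k l) = 0.
Proof.
have [s sj] := exists_other j; have [t tk] := exists_other k.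
have [p pj] := exists_other j; have [q qk] := exists_other k.
rewrite (@partE i j t s) ?sj ?orbT // (@part_trE l k p q) ?qk ?orbT //.
rewrite !starM starK -!mulrA (mulrA (e t j)) (grid_ortho_star eG) ?tk 1?eq_sym //.
by rewrite mul0r !mulr0.
Qed.

Lemma grid_star_part_tr i j k l : star (a i j) * b k l = 0.
Proof.
have [s sl] := exists_other l; have [t ti] := exists_other i.
have [p pl] := exists_other l; have [q qi] := exists_other i.
rewrite (@partE i j t s) ?ti // (@part_trE l k p q) ?pl //.
rewrite !starM starK -!mulrA (mulrA (star (e i s))) (grid_ortho eG) // 1?eq_sym //.
by rewrite mul0r !mulr0.
Qed.

Lemma grid_part_tr_star i j k l : b i j * star (a k l) = 0.
Proof. by rewrite -[LHS]starK starM starK grid_part_star_tr star0. Qed.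

Lemma grid_star_tr_part i j k l : star (b i j) * a k l = 0.
Proof. by rewrite -[LHS]starK starM starK grid_star_part_tr star0. Qed.

Lemma grid_product i j k l p q :
  e i j * star (e k l) * e p q =
  a i q *+ ((j == l) && (k == p)) + b p j *+ ((i == k) && (l == q)).
Proof.
have [<-|ik] := eqVneq i k; have [<-|jl] := eqVneq j l;
  (have [<-|kp] := eqVneq _ p); (have [<-|lq] := eqVneq _ q);
  rewrite /= ?mulr0n ?mulr1n ?addr0 ?add0r //;
  try by [rewrite (grid_ortho_star eG) // mul0r
         |rewrite -mulrA (grid_ortho eG) // mulr0].
- by rewrite (grid_tripotent eG) grid_split.
- by rewrite (@partE i q i j) ?lq ?orbT.
- by rewrite (@part_trE j p j i) ?kp ?orbT.
- by rewrite (@part_trE j i l i) // eq_sym jl.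
(* Neighbouring factors share a row here. An exchange moves the first two to row [t], which makes
   the last two orthogonal; the last bullet does the same with columns. *)
- have [t ti] := exists_other i.
  rewrite (grid_exchange (jordan_grid_tr eG) i t) // -mulrA.
  by rewrite (grid_ortho eG) // mulr0.
- by rewrite (@part_trE j p l i) // eq_sym jl.
- by rewrite (@partE i j k j) // eq_sym ik.
- by rewrite (@partE i q k j) // eq_sym ik.
- have [t tj] := exists_other j.
  by rewrite (grid_exchange eG j t) // -mulrA (grid_ortho eG) // mulr0.
Qed.

(** Inserting e = a + b into [grid_product] kills all mixed terms and leaves the sum of the two
    claims. The element [u], which is (E_qq, 0) in the model, then separates them. *)
Lemma grid_parts_product i j k l p q :
  a i j * star (a k l) * a p q = a i q *+ ((j == l) && (k == p)) /\
  b i j * star (b k l) * b p q = b p j *+ ((i == k) && (l == q)).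
Proof.
set x := _ * _ * a p q; set x' := a i q *+ _.
set y := _ * _ * b p q; set y' := b p j *+ _.
have xy : x + y = x' + y'.
  rewrite -grid_product !grid_split starD.
  have -> : (a i j + b i j) * (star (a k l) + star (b k l)) =
      a i j * star (a k l) + b i j * star (b k l).
    by rewrite mulrDl !mulrDr grid_part_star_tr grid_part_tr_star addr0 add0r.
  rewrite mulrDl !mulrDr -(mulrA (a i j) _ (b p q)) -(mulrA (b i j) _ (a p q)).
  by rewrite grid_star_part_tr grid_star_tr_part !mulr0 addr0 add0r.
have [s sq] := exists_other q.
(* [u] fixes the [a i q] and annihilates the [b k l], so it separates the two
   summands. *)
pose u := star (e p q) * e p s * (star (e p s) * e p q).
have au i' : a i' q * u = a i' q.
  rewrite /u (grid_exchange_star eG p i') 1?eq_sym // mulrA.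
  by rewrite grid_part_rmul // (grid_exchange_star eG p i') // grid_part_rmul // eq_sym.
have bu k' l' : b k' l' * u = 0.
  have [t tk] := exists_other k'; have [r rq] := exists_other q.
  have z : e k' r * star (e t q) = 0 by rewrite (grid_ortho_star eG) // eq_sym.
  rewrite /u (grid_exchange_star eG p t) 1?eq_sym //.
  rewrite (@part_trE l' k' r t) ?tk ?orbT // !mulrA -(mulrA _ (e k' r)).
  by rewrite z mulr0 !mul0r.
have xu : x * u = x by rewrite /x -mulrA au.
have x'u : x' * u = x' by rewrite /x' mulrnAl au.
have yu : y * u = 0 by rewrite /y -mulrA bu mulr0.
have y'u : y' * u = 0 by rewrite /y' mulrnAl bu mul0rn.
have xx' : x = x'.
  by have := congr1 (fun z => z * u) xy; rewrite !mulrDl xu x'u yu y'u !addr0.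
by split=> //; move: xy; rewrite xx' => /addrI.
Qed.
End TwoParts.
End Grid.

(** * Trilinear products and the ring of adjointable operators *)

Definition sesquitrilinear (C : numClosedFieldType) (V : lmodType C)
    (p : V -> V -> V -> V) : Prop :=
  [/\ forall l x x' y z, p (l *: x + x') y z = l *: p x y z + p x' y z,
      forall l x y y' z, p x (l *: y + y') z = Num.conj l *: p x y z + p x y' z
    & forall l x y z z', p x y (l *: z + z') = l *: p x y z + p x y z'].

Lemma sesquitrilinear0 (C : numClosedFieldType) (V : lmodType C)
    (p : V -> V -> V -> V) : sesquitrilinear p ->
  forall x y, [/\ p 0 x y = 0, p x 0 y = 0 & p x y 0 = 0].
Proof.
case=> p1 p2 p3 x y; split; apply/eqP.
- by have /esym/eqP := p1 1 0 0 x y; rewrite !scale1r addr0 -subr_eq0 addrK.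
- by have /esym/eqP := p2 1 x 0 0 y;
    rewrite conjC1 !scale1r addr0 -subr_eq0 addrK.
- by have /esym/eqP := p3 1 x y 0 0; rewrite !scale1r addr0 -subr_eq0 addrK.
Qed.

(** * Extending identities from matrix units *)

Section Trilinear.
Variables (C : numClosedFieldType) (n m : nat).

Lemma mx_linear_ind (P : 'M[C]_(n, m) -> Prop) : P 0 ->
  (forall l x y, P x -> P y -> P (l *: x + y)) ->
  (forall i j, P (delta_mx i j)) -> forall x, P x.
Proof.
move=> P0 PD PE x; rewrite (matrix_sum_delta x).
have PA a b : P a -> P b -> P (a + b).
  by move=> Pa Pb; rewrite -[a]scale1r; exact: PD.
apply: (big_ind P) => // i _; apply: (big_ind P) => // j _.
by rewrite -[_ *: _]addr0; exact: PD.
Qed.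

Lemma sesquitrilinear_ext (V : lmodType C) (p : V -> V -> V -> V)
    (q : 'M[C]_(n, m) -> 'M_(n, m) -> 'M_(n, m) -> 'M_(n, m))
    (f : {linear 'M[C]_(n, m) -> V}) :
  sesquitrilinear p -> sesquitrilinear q ->
  (forall i j k l s t, p (f (delta_mx i j)) (f (delta_mx k l)) (f (delta_mx s t))
     = f (q (delta_mx i j) (delta_mx k l) (delta_mx s t))) ->
  forall x y z, p (f x) (f y) (f z) = f (q x y z).
Proof.
move=> [p1 p2 p3] [q1 q2 q3] fE.
(* [fs] passes from matrix units to all matrices in one variable; [c] is the identity, or
   conjugation for the middle variable. *)
have fs (r : V -> V) (r' : 'M[C]_(n, m) -> 'M_(n, m)) (c : C -> C) : c 1 = 1 ->
    (forall l x y, r (l *: x + y) = c l *: r x + r y) ->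
    (forall l x y, r' (l *: x + y) = c l *: r' x + r' y) ->
    (forall i j, r (f (delta_mx i j)) = f (r' (delta_mx i j))) ->
    forall x, r (f x) = f (r' x).
  move=> c1 rl rl' rE.
  have zero (W W' : lmodType C) (g : W -> W') :
      (forall l x y, g (l *: x + y) = c l *: g x + g y) -> g 0 = 0.
    move=> gl; apply: (addIr (g 0)).
    by rewrite add0r -[X in X + _]scale1r -{1}c1 -gl scaler0 addr0.
  apply: mx_linear_ind => //.
    by rewrite linear0 (zero _ _ _ rl) (zero _ _ _ rl') linear0.
  by move=> l x y hx hy; rewrite linearP rl rl' linearP hx hy.
have h1 i j k l z : p (f (delta_mx i j)) (f (delta_mx k l)) (f z) =
    f (q (delta_mx i j) (delta_mx k l) z).
  by apply: (fs (p _ _) (q _ _) id) => // *; rewrite ?p3 ?q3.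
have h2 i j y z : p (f (delta_mx i j)) (f y) (f z) = f (q (delta_mx i j) y z).
  by apply: (fs (fun y => p _ y _) (fun y => q _ y _) Num.conj) => [|*|*|*];
    rewrite ?conjC1 ?p2 ?q2.
move=> x y z.
by apply: (fs (fun x => p x _ _) (fun x => q x _ _) id) => // *; rewrite ?p1 ?q1.
Qed.

End Trilinear.

Section MatrixTriple.
Variables (R : realType) (n m : nat).
Local Notation M := 'M[R[i]]_(n, m).

Lemma mx_triple_sesquitrilinear : sesquitrilinear (@mx_triple R n m).
Proof.
split=> l x y z w; rewrite /mx_triple.
- by rewrite !mulmxDl -!scalemxAl.
- have -> : map_mx Num.conj (l *: y + z)^T =
      Num.conj l *: map_mx Num.conj y^T + map_mx Num.conj z^T.
    by apply/matrixP=> i j; rewrite !mxE rmorphD rmorphM.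
  by rewrite mulmxDr mulmxDl -scalemxAr -scalemxAl.
- by rewrite mulmxDr -scalemxAr.
Qed.

Lemma jordan_sesquitrilinear (V : lmodType R[i]) (p : V -> V -> V -> V) :
  sesquitrilinear p -> sesquitrilinear (jordan p).
Proof.
have h (l : R[i]) (a b c d : V) : 2^-1 *: (l *: a + b + (l *: c + d)) =
    l *: (2^-1 *: (a + c)) + 2^-1 *: (b + d).
  by rewrite addrACA -scalerDr [LHS]scalerDr !scalerA mulrC. 
by case=> p1 p2 p3; split=> l x y z w; rewrite /jordan ?p1 ?p2 ?p3 h.
Qed.

Lemma jordan_diag (V : lmodType R[i]) (p : V -> V -> V -> V) x y :
  jordan p x y x = p x y x.
Proof. by rewrite /jordan scalerDr -scalerDl -[2^-1]mul1r -splitr scale1r. Qed.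

Lemma mx_triple_delta i j k l p q :
  mx_triple (delta_mx i j) (delta_mx k l) (delta_mx p q) =
  (delta_mx i q *+ ((j == l) && (k == p)) : M).
Proof.
rewrite /mx_triple trmx_delta map_delta_mx mul_delta_mx_cond.
case: eqVneq => _; last by rewrite mul0mx.
by rewrite mulr1n mul_delta_mx_cond.
Qed.

(** This product reads off a single entry of [x]; the injectivity proofs below rest on it. *)
Lemma mx_triple_delta_diag i j (x : M) :
  mx_triple (delta_mx i j) x (delta_mx i j) = Num.conj (x i j) *: delta_mx i j.
Proof.
have [_ q2 _] := mx_triple_sesquitrilinear.
move: x; apply: mx_linear_ind => [|l x y hx hy|k l].
- rewrite mxE conjC0 scale0r.
  by have [] := sesquitrilinear0 mx_triple_sesquitrilinear (delta_mx i j)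
    (delta_mx i j).
- by rewrite q2 hx hy scalerA -scalerDl !mxE rmorphD rmorphM.
- rewrite mx_triple_delta mxE [k == i]eq_sym andbC.
  by case: (_ && _); rewrite ?conjC1 ?conjC0 ?scale1r ?scale0r.
Qed.

Lemma mx_triple_0m (x : M) : mx_triple 0 x 0 = 0.
Proof. by case: (sesquitrilinear0 (mx_triple_sesquitrilinear) x 0). Qed.

End MatrixTriple.

(** * The ring with involution of operators that have an adjoint *)

Section Adjointable.
Variables (R : realType) (H : hilbertSpace R).
Local Notation C := R[i].
Local Notation dot := (hilbert_dot H).

Lemma dotDl (x y z : H) : dot (x + y) z = dot x z + dot y z.
Proof. exact: linearDl. Qed.

Lemma dotZl l (x z : H) : dot (l *: x) z = l * dot x z.
Proof. exact: linearZl_LR. Qed.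

Lemma dotBl (x y z : H) : dot (x - y) z = dot x z - dot y z.
Proof. exact: linearBl. Qed.

Lemma dot_suml (I : finType) (x : I -> H) z :
  dot (\sum_i x i) z = \sum_i dot (x i) z.
Proof. exact: linear_sumlz. Qed.

Lemma dotDr (x y z : H) : dot z (x + y) = dot z x + dot z y.
Proof. exact: linearDr. Qed.

Lemma dotZr l (x z : H) : dot z (l *: x) = Num.conj l * dot z x.
Proof. exact: linearZr_LR. Qed.

Lemma dotC (x y : H) : dot x y = Num.conj (dot y x).
Proof. by have := hermC dot x y; rewrite expr0 mul1r. Qed.

Lemma dot_inj (x y : H) : (forall z, dot x z = dot y z) -> x = y.
Proof.
move=> h; apply/eqP; rewrite -subr_eq0 -(dnorm_eq0 dot).
by rewrite dotBl h subrr.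
Qed.

Lemma dot_injr (x y : H) : (forall z, dot z x = dot z y) -> x = y.
Proof. by move=> h; apply: dot_inj => z; rewrite dotC h -dotC. Qed.

Lemma cauchy_schwarz (x y : H) : `|dot x y| <= `|x| * `|y|.
Proof.
have [->|y0] := eqVneq y 0.
  by have -> : dot x 0 = 0 by [exact: linear0r]; rewrite !normr0 mulr0.
rewrite -(@ler_pXn2r _ 2) ?nnegrE ?mulr_ge0 // exprMn !hilbert_normE.
have y2 : 0 < dot y y by rewrite dnorm_gt0.
rewrite -(ler_pM2l y2) -subr_ge0.
(* The squared norm of this vector is <y,y> (<x,x> <y,y> - |<x,y>|^2). *)
have := dnorm_ge0 dot (dot y y *: x - dot x y *: y).
rewrite -scaleN1r !(dotDl, dotDr, dotZl, dotZr) -!(dotC y y) (dotC y x).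
rewrite normCK rmorphN1; set a := dot x y; set b := Num.conj a.
by congr (0 <= _); ring.
Qed.

Definition is_adjoint (f g : H -> H) : Prop :=
  forall x y, dot (f x) y = dot x (g y).

Lemma is_adjoint_uniq f g h : is_adjoint f g -> is_adjoint f h -> g = h.
Proof.
by move=> fg fh; apply/funext => y; apply: dot_injr => x; rewrite -fg fh.
Qed.

Lemma is_adjoint_sym f g : is_adjoint f g -> is_adjoint g f.
Proof. by move=> fg x y; rewrite dotC -fg -dotC. Qed.

Lemma adjointE f g : is_adjoint f g -> adjoint f = g.
Proof.
move=> fg; rewrite /adjoint; case: xgetP => [h _ fh|/(_ g)]//.
exact: is_adjoint_uniq fh fg.
Qed.

Lemma is_adjoint_linear f g : is_adjoint f g -> linear f.
Proof.
by move=> fg l x y; apply: dot_inj => z; rewrite dotDl dotZl !fg dotDl dotZl.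
Qed.

(** Bundling the existence of an adjoint yields a ring to which the grid algebra applies, and on
    which [adjoint] never takes its default value. *)
Record adjointable := Adjointable {
  adj_op :> H -> H;
  adj_opP : exists g, is_adjoint adj_op g }.

Lemma adjointable_inj (f g : adjointable) : f = g :> (H -> H) -> f = g.
Proof.
case: f g => f fP [g gP] /= fg; rewrite fg in fP *.
by congr Adjointable; exact: Prop_irrelevance.
Qed.

Lemma adjP (f : adjointable) : is_adjoint f (adjoint f).
Proof. by case: (adj_opP f) => g fg; rewrite (adjointE fg). Qed.

HB.instance Definition _ := gen_eqMixin adjointable.
HB.instance Definition _ := gen_choiceMixin adjointable.

Fact adj_add_subproof (f g : adjointable) :
  is_adjoint (fun x => f x + g x) (fun x => adjoint f x + adjoint g x).
Proof. by move=> x y; rewrite dotDl dotDr !adjP. Qed.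
Definition adj_add f g := Adjointable (ex_intro _ _ (adj_add_subproof f g)).

Fact adj_scale_subproof l (f : adjointable) :
  is_adjoint (fun x => l *: f x) (fun x => Num.conj l *: adjoint f x).
Proof. by move=> x y; rewrite dotZl dotZr adjP conjCK. Qed.
Definition adj_scale l f := Adjointable (ex_intro _ _ (adj_scale_subproof l f)).

Fact adj_mul_subproof (f g : adjointable) :
  is_adjoint (fun x => f (g x)) (fun x => adjoint g (adjoint f x)).
Proof. by move=> x y; rewrite !adjP. Qed.
Definition adj_mul f g := Adjointable (ex_intro _ _ (adj_mul_subproof f g)).

Fact adj_zero_subproof : is_adjoint (fun=> 0) (fun=> 0).
Proof. by move=> x y; rewrite linear0l linear0r. Qed.
Definition adj_zero := Adjointable (ex_intro _ _ adj_zero_subproof).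

Fact adj_one_subproof : is_adjoint id id. Proof. by []. Qed.
Definition adj_one := Adjointable (ex_intro _ _ adj_one_subproof).

Definition adj_star (f : adjointable) :=
  Adjointable (ex_intro _ _ (is_adjoint_sym (adjP f))).

Lemma adj_linear (f : adjointable) : linear f.
Proof. exact: is_adjoint_linear (adjP f). Qed.

Lemma adj_opD (f : adjointable) x y : f (x + y) = f x + f y.
Proof. by rewrite -[x in LHS]scale1r (adj_linear f) scale1r. Qed.

Lemma adj_opZ (f : adjointable) l x : f (l *: x) = l *: f x.
Proof.
have f0 : f 0 = 0 by apply: (addIr (f 0)); rewrite -adj_opD !add0r.
by rewrite -[l *: x]addr0 (adj_linear f) f0 addr0.
Qed.

Local Ltac adj := apply: adjointable_inj; apply/funext => /= ?.

Fact adj_addA : associative adj_add. Proof. by move=> *; adj; rewrite addrA. Qed.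
Fact adj_addC : commutative adj_add. Proof. by move=> *; adj; rewrite addrC. Qed.
Fact adj_add0 : left_id adj_zero adj_add.
Proof. by move=> *; adj; rewrite add0r. Qed.
Fact adj_addN : left_inverse adj_zero (adj_scale (-1)) adj_add.
Proof. by move=> *; adj; rewrite scaleN1r addNr. Qed.
HB.instance Definition _ :=
  GRing.isZmodule.Build adjointable adj_addA adj_addC adj_add0 adj_addN.

Fact adj_mulA : associative adj_mul. Proof. by move=> *; adj. Qed.
Fact adj_mul1 : left_id adj_one adj_mul. Proof. by move=> *; adj. Qed.
Fact adj_mulr1 : right_id adj_one adj_mul. Proof. by move=> *; adj. Qed.
Fact adj_mulDl : left_distributive adj_mul adj_add. Proof. by move=> *; adj. Qed.
Fact adj_mulDr : right_distributive adj_mul adj_add.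
Proof.
by move=> f g h; adj; rewrite adj_opD.
Qed.
HB.instance Definition _ := GRing.Zmodule_isPzRing.Build adjointable
  adj_mulA adj_mul1 adj_mulr1 adj_mulDl adj_mulDr.

Fact adj_scaleA a b v : adj_scale a (adj_scale b v) = adj_scale (a * b) v.
Proof. by adj; rewrite scalerA. Qed.
Fact adj_scale1 : left_id 1 adj_scale.
Proof. by move=> *; adj; rewrite scale1r. Qed.
Fact adj_scaleDr : right_distributive adj_scale +%R.
Proof. by move=> *; adj; rewrite scalerDr. Qed.
Fact adj_scaleDl v : {morph adj_scale^~ v : a b / a + b}.
Proof. by move=> *; adj; rewrite scalerDl. Qed.
HB.instance Definition _ := GRing.Zmodule_isLmodule.Build C adjointable
  adj_scaleA adj_scale1 adj_scaleDr adj_scaleDl.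

Lemma adj_star_involution : involution adj_star.
Proof.
split=> [f|f g|f g]; apply: adjointable_inj => /=.
- exact: adjointE (is_adjoint_sym (adjP f)).
- exact: adjointE (adj_add_subproof f g).
- exact: adjointE (adj_mul_subproof f g).
Qed.

Lemma adj_starZ l f : adj_star (l *: f) = Num.conj l *: adj_star f.
Proof. by apply: adjointable_inj; exact: adjointE (adj_scale_subproof l f). Qed.

Definition adj_triple (f g h : adjointable) : adjointable := f * adj_star g * h.

Lemma adj_tripleE f g h : adj_triple f g h = op_triple f g h :> (H -> H).
Proof. by []. Qed.

Lemma adj_triple_sesquitrilinear : sesquitrilinear adj_triple.
Proof.
have [_ sD _] := adj_star_involution.
split=> l x y z y'; apply: adjointable_inj; apply/funext => t; rewrite /adj_triple.
- by [].
- have -> : adj_star (l *: y + z) = Num.conj l *: adj_star y + adj_star z.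
    by rewrite sD adj_starZ.
  by rewrite /= adj_opD adj_opZ.
- exact: etrans (congr1 x (adj_linear (adj_star y) l (z t) (y' t)))
    (adj_linear x _ _ _).
Qed.

End Adjointable.

(** * Finite-dimensional Hilbert spaces *)

(** A separate name for column vectors keeps the Euclidean norm apart from any norm that matrices
    already carry. *)
Definition l2 (R : realType) (d : nat) : Type := 'cV[R[i]]_d.

Section L2.
Variables (R : realType) (d : nat).
Local Notation C := R[i].
Local Notation l2 := (l2 R d).

HB.instance Definition _ := GRing.Lmodule.on l2.
HB.instance Definition _ := Vector.on l2.

Definition l2_dot (x y : l2) : C := \sum_i x i ord0 * Num.conj (y i ord0).

Fact l2_dot_bilinear : bilinear_for *%R (Num.conj \; *%R) l2_dot.
Proof.
split=> z l x y; rewrite /l2_dot /= big_distrr -big_split /=;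
  apply: eq_bigr => i _; rewrite !mxE.
- by rewrite mulrDl mulrA.
- by rewrite rmorphD rmorphM mulrDr mulrCA.
Qed.
HB.instance Definition _ := bilinear_isBilinear.Build _ _ _ _ _ _ l2_dot
  l2_dot_bilinear.

Fact l2_dot_herm (x y : l2) :
  l2_dot x y = (-1) ^+ false * Num.conj (l2_dot y x).
Proof.
rewrite expr0 mul1r /l2_dot rmorph_sum; apply: eq_bigr => i _.
by rewrite rmorphM /= conjCK mulrC.
Qed.
HB.instance Definition _ := isHermitianSesquilinear.Build _ _ _ _ l2_dot
  l2_dot_herm.

Fact l2_dot_gt0 (x : l2) : x != 0 -> 0 < l2_dot x x.
Proof.
move=> x0; have ge0 i : 0 <= x i ord0 * Num.conj (x i ord0) by rewrite mul_conjC_ge0.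
rewrite lt_def sumr_ge0 // andbT; apply: contra x0.
rewrite psumr_eq0 // => /allP h; apply/eqP/matrixP => i j.
have /= := h i (mem_index_enum _); rewrite mul_conjC_eq0 => /eqP xi.
by rewrite (ord1 j) xi mxE.
Qed.
HB.instance Definition _ := isDotProduct.Build _ _ l2_dot l2_dot_gt0.

Fact l2_normD (x y : l2) :
  sqrtC (l2_dot (x + y) (x + y)) <= sqrtC (l2_dot x x) + sqrtC (l2_dot y y).
Proof. exact: triangle_lerif. Qed.

Fact l2_normZ (l : C) (x : l2) :
  sqrtC (l2_dot (l *: x) (l *: x)) = `|l| * sqrtC (l2_dot x x).
Proof.
by rewrite (dnormZ l2_dot) sqrtCM ?nnegrE ?exprn_ge0 ?(dnorm_ge0 l2_dot) ?sqrCK.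
Qed.

Fact l2_norm_eq0 (x : l2) : sqrtC (l2_dot x x) = 0 -> x = 0.
Proof. by move/eqP; rewrite (sqrt_dnorm_eq0 l2_dot) => /eqP. Qed.

HB.instance Definition _ := Lmodule_isNormed.Build C l2
  l2_normD l2_normZ l2_norm_eq0.

Lemma l2_normE (x : l2) : `|x| = sqrtC (l2_dot x x). Proof. by []. Qed.

Lemma l2_coord_le (x : l2) i : `|x i ord0| <= `|x|.
Proof.
rewrite l2_normE -(sqrCK (normr_ge0 _)) ler_sqrtC ?nnegrE ?exprn_ge0 //;
  last exact: (dnorm_ge0 l2_dot).
rewrite normCK /l2_dot (bigD1 i) //= lerDl sumr_ge0 // => j _.
exact: mul_conjC_ge0.
Qed.

Lemma l2_sum_delta (x : l2) : x = \sum_i x i ord0 *: (delta_mx i ord0 : l2).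
Proof.
apply/matrixP=> i j; rewrite summxE (bigD1 i) //= !mxE !ord1 !eqxx mulr1.
by rewrite big1 ?addr0 // => k ki; rewrite !mxE eq_sym (negPf ki) mulr0.
Qed.

Lemma l2_norm_delta i : `|(delta_mx i ord0 : l2)| = 1.
Proof.
rewrite l2_normE /l2_dot (bigD1 i) //= !mxE !eqxx conjC1 mulr1 big1 ?addr0 ?sqrtC1 //.
by move=> k ki; rewrite !mxE (negPf ki) mul0r.
Qed.

Lemma l2_norm_le (x : l2) : `|x| <= \sum_i `|x i ord0|.
Proof.
rewrite [in leLHS](l2_sum_delta x).
apply: le_trans (ler_norm_sum _ _ _) _; apply: ler_sum => i _.
by rewrite normrZ l2_norm_delta mulr1.
Qed.

Lemma norm_le_ReIm (z : C) : `|z| <= (`|complex.Re z| + `|complex.Im z|)%:C.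
Proof.
rewrite normc_def lecR -[leRHS]ger0_norm ?addr_ge0 // -sqrtr_sqr ler_wsqrtr //.
rewrite sqrrD !real_normK ?num_real // addrAC lerDl.
by rewrite mulrn_wge0 // mulr_ge0.
Qed.

Lemma normc_ge_Im (z : C) : `|complex.Im z|%:C <= `|z|.
Proof.
by rewrite normc_def lecR -sqrtr_sqr ler_wsqrtr // lerDr sqr_ge0.
Qed.

Lemma ReB (z w : C) : complex.Re z - complex.Re w = complex.Re (z - w).
Proof. by case: z; case: w. Qed.

Lemma ImB (z w : C) : complex.Im z - complex.Im w = complex.Im (z - w).
Proof. by case: z; case: w. Qed.

Lemma l2_cauchy_coord (f : l2 -> R) (F : set_system l2) : ProperFilter F ->
  (forall x y, `|f x - f y|%:C <= `|x - y|) -> cauchy F -> cvg (f @ F).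
Proof.
move=> FF fl Fc; apply/cauchy_cvgP/cauchy_ballP => e e0.
have /cauchy_ballP/(_ e%:C) := Fc; rewrite ltcR => /(_ e0).
move=> [[P Q] [/= FP FQ] PQ].
exists (f @` P, f @` Q).
  by split; [apply: filterS FP|apply: filterS FQ] => x; exists x.
move=> [_ _] [/= [x Px <-] [y Qy <-]].
have := PQ (x, y) (conj Px Qy); rewrite -!ball_normE /= => xy.
by rewrite -ltcR; exact: le_lt_trans (fl _ _) xy.
Qed.

(** The real and imaginary parts of the coordinates are contractions, so completeness reduces to
    that of the reals. *)
Fact l2_complete (F : set_system l2) : ProperFilter F -> cauchy F -> cvg F.
Proof.
move=> FF Fc.
have Rec i : cvg ((fun x : l2 => complex.Re (x i ord0)) @ F).
  apply: l2_cauchy_coord => // x y.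
  apply: le_trans (l2_coord_le _ i); rewrite ReB !mxE; exact: normc_ge_Re.
have Imc i : cvg ((fun x : l2 => complex.Im (x i ord0)) @ F).
  apply: l2_cauchy_coord => // x y.
  apply: le_trans (l2_coord_le _ i); rewrite ImB !mxE; exact: normc_ge_Im.
pose L : l2 := \col_i (lim ((fun x : l2 => complex.Re (x i ord0)) @ F) +i*
                  lim ((fun x : l2 => complex.Im (x i ord0)) @ F)).
apply/cvg_ex; exists L; apply/cvgrPdist_le => e; rewrite ltcE => /andP[/eqP Ie Re0].
have {Ie} eE : e = (complex.Re e)%:C by case: e Ie {Re0} => a b /= ->.
(* Each of the [d] coordinates will have modulus at most 2 r = e / (d + 1), so their sum stays below
   e; dividing by d + 1 covers d = 0. *)
pose r := complex.Re e / d.+1%:R / 2.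
have r0 : 0 < r by rewrite !divr_gt0 ?ltr0n.
have near_coord : \forall x \near F, forall i,
    `|complex.Re ((L - x) i ord0)| <= r /\ `|complex.Im ((L - x) i ord0)| <= r.
  apply: filter_forall => i.
  have /cvgrPdist_le/(_ r r0) := Rec i; have /cvgrPdist_le/(_ r r0) := Imc i.
  by apply: filterS2 => x hx hy; rewrite !mxE -ReB -ImB.
apply: filterS near_coord => x xr; apply: le_trans (l2_norm_le _) _.
have xe i : `|(L - x) i ord0| <= (r + r)%:C.
  have [x1 x2] := xr i; apply: le_trans (norm_le_ReIm _) _.
  by rewrite lecR lerD.
apply: le_trans (ler_sum _ (fun i _ => xe i)) _.
rewrite sumr_const card_ord -rmorphMn /= [leRHS]eE lecR.
have -> : r + r = complex.Re e / d.+1%:R by rewrite /r -splitr.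
rewrite -mulr_natr mulrAC ler_pdivrMr ?ltr0n // ler_wpM2l ?ler_nat //.
exact: ltW.
Qed.
HB.instance Definition _ := Uniform_isComplete.Build l2 l2_complete.

Fact l2_hilbert (x : l2) : `|x| ^+ 2 = l2_dot x x.
Proof. by rewrite l2_normE sqrtCK. Qed.
Definition l2_space : hilbertSpace R := HilbertSpace l2_hilbert.

End L2.

(** * Operators on l2 and spans of orthogonal families *)

Section L2Operators.
Variables (R : realType) (d : nat).
Local Notation C := R[i].
Local Notation K := (l2_space R d).

Lemma l2_linear_bounded (f : K -> K) : linear f -> bounded_operator f.
Proof.
move=> fl; split=> //; exists (\sum_i `|f (delta_mx i ord0)|) => x.
pose g : {linear K -> K} :=
  HB.pack f (GRing.isLinear.Build C K K *:%R f fl).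
have -> : f x = \sum_i x i ord0 *: f (delta_mx i ord0).
  rewrite -[f]/(g : K -> K) [in LHS](l2_sum_delta x) linear_sum.
  by apply: eq_bigr => i _; rewrite linearZ.
apply: le_trans (ler_norm_sum _ _ _) _.
rewrite mulr_suml; apply: ler_sum => i _.
by rewrite normrZ mulrC ler_wpM2l //; exact: l2_coord_le.
Qed.

(** An existing adjoint is itself adjointable, and the default value 0 is linear too. *)
Lemma adjoint_is_linear (H : hilbertSpace R) (f : H -> H) : linear (adjoint f).
Proof.
rewrite /adjoint; case: xgetP => [g _ fg|_] l x y.
  exact: (is_adjoint_linear (is_adjoint_sym fg)).
by rewrite /= scaler0 addr0.
Qed.

(** This TRO is the codomain in which the universal property gets tested. *)
Lemma l2_bounded_TRO : is_TRO (@bounded_operator R K).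
Proof.
split=> //.
- split=> [|l f g [fl _] [gl _]].
    by apply: l2_linear_bounded => l x y; rewrite /= scaler0 addr0.
  apply: l2_linear_bounded => a x y; rewrite !fctE fl gl.
  by rewrite !scalerDr !scalerA addrACA (mulrC l).
- move=> f g h [fl _] _ [hl _]; apply: l2_linear_bounded => a x y.
  by rewrite /op_triple /= hl adjoint_is_linear fl.
Qed.

Definition mx_op (X : 'M[C]_d) : K -> K := fun v => X *m v.

Lemma mx_op_adjoint X : is_adjoint (mx_op X) (mx_op (map_mx Num.conj X^T)).
Proof.
move=> x y; rewrite /= /l2_dot /mx_op.
under eq_bigr do rewrite mxE mulr_suml.
under [RHS]eq_bigr do rewrite mxE rmorph_sum mulr_sumr.
rewrite exchange_big /=; apply: eq_bigr => i _; apply: eq_bigr => j _.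
by rewrite !mxE rmorphM /= conjCK mulrCA mulrA.
Qed.

Lemma mx_op_triple X Y Z :
  op_triple (mx_op X) (mx_op Y) (mx_op Z) = mx_op (mx_triple X Y Z).
Proof.
apply/funext=> v; rewrite /op_triple (adjointE (mx_op_adjoint Y)) /mx_op /=.
by rewrite /mx_triple !mulmxA.
Qed.

Lemma mx_op_linear : linear mx_op.
Proof.
by move=> l X Y; apply/funext=> v; rewrite /mx_op mulmxDl -scalemxAl.
Qed.

Lemma mx_op_bounded X : bounded_operator (mx_op X).
Proof.
by apply: l2_linear_bounded => l x y; rewrite /mx_op mulmxDr -scalemxAr.
Qed.

Lemma mx_op_inj X : mx_op X = 0 -> X = 0.
Proof.
move=> h; apply/matrixP=> i j.
have /matrixP/(_ i ord0) : mx_op X (delta_mx j ord0) = 0 by rewrite h.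
by rewrite /mx_op -(colE j) !mxE.
Qed.

End L2Operators.

(** * Rectangular matrices as operators on one space *)

Section Corner.
Variables (R : realType) (n m : nat).
Local Notation C := R[i].

(** A TRO consists of operators on a single space; the upper right block of a square matrix keeps
    its shape under x y^* z. *)
Definition corner (x : 'M[C]_(n, m)) : l2_space R (n + m) -> l2_space R (n + m) :=
  mx_op (block_mx 0 x 0 0).

Lemma corner_linear : linear corner.
Proof.
move=> l x y; rewrite /corner -mx_op_linear scale_block_mx add_block_mx.
by rewrite !scaler0 !addr0.
Qed.

HB.instance Definition _ := GRing.isLinear.Build C _ _ _ corner corner_linear.

Lemma corner_triple x y z :
  op_triple (corner x) (corner y) (corner z) = corner (mx_triple x y z).
Proof.
rewrite /corner mx_op_triple /mx_triple tr_block_mx map_block_mx !mulmx_block.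
by rewrite !trmx0 !map_mx0 !(mul0mx, mulmx0, addr0, add0r).
Qed.

Lemma corner_eq0 x : corner x = 0 -> x = 0.
Proof.
move/mx_op_inj/(congr1 ursubmx); rewrite block_mxKur => ->.
by apply/matrixP=> i j; rewrite !mxE.
Qed.

End Corner.

(** * Closedness of the span of a finite orthogonal family *)

Section OrthogonalFamily.
Variables (R : realType) (H : hilbertSpace R) (I : finType).
Variable (t : I -> adjointable H).
Hypothesis t_ortho : forall i j, t i * adj_star (t j) * t i = t i *+ (i == j).
Hypothesis t_neq0 : forall i, t i != 0.
Local Notation C := R[i].
Local Notation dot := (hilbert_dot H).

(** With x = t_i^* t_i v and y a multiple of t_i v, using t_i = t_i t_i^* t_i inside the inner
    product replaces t_j by t_i t_i^* t_j. Now t_i t_i^* t_j t_i^* t_i = t_i (t_i t_j^* t_i)^* t_i,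
    which is 0 unless i = j. *)
Lemma dual_vectors i :
  exists x y, forall j, dot (t j x) y = (i == j)%:R.
Proof.
have [v tv] : exists v, t i v != 0.
  apply: contrapT => h; move/eqP: (t_neq0 i); apply; apply: adjointable_inj.
  apply/funext=> v /=; apply/eqP; apply: contrapT => tv.
  by apply: h; exists v; exact/negP.
have tv2 : dot (t i v) (t i v) != 0 by rewrite dnorm_eq0.
exists (adj_star (t i) (t i v)), ((Num.conj (dot (t i v) (t i v)))^-1 *: t i v) => j.
rewrite dotZr fmorphV /= conjCK.
have sI := adj_star_involution H; have [sK sD sM] := sI.
have h : t i * adj_star (t i) * t j * adj_star (t i) * t i = t i *+ (i == j).
  have -> : t i * adj_star (t i) * t j * adj_star (t i) * t i =
      t i * adj_star (t i * adj_star (t j) * t i) * t i.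
    by rewrite !sM sK !mulrA.
  rewrite t_ortho; have [ij|_] := eqVneq i j; last first.
    by rewrite !mulr0n (star0 sI) mulr0 mul0r.
  by have := t_ortho i i; rewrite eqxx !mulr1n.
have -> : dot (t j (adj_star (t i) (t i v))) (t i v) =
    dot ((t i * adj_star (t i) * t j * adj_star (t i) * t i) v) (t i v).
  have -> : dot (t j (adj_star (t i) (t i v))) (t i v) =
      dot (t j (adj_star (t i) (t i v))) ((t i * adj_star (t i) * t i) v).
    by rewrite t_ortho eqxx.
  exact: etrans (esym (is_adjoint_sym (adjP (t i)) _ _)) (esym (adjP (t i) _ _)).
rewrite h; case: eqP => _; first by rewrite mulVf.
by have -> : dot ((t i *+ false) v) (t i v) = 0 by [exact: linear0l]; rewrite mulr0.
Qed.

(** The dual vectors give coordinates c_i = <f x_i, y_i>, also when [f] is only a limit. An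
    approximant within e has coordinates within e |x_i| |y_i| of these, so [f] and the combination
    with coefficients [c] differ at [v] by at most e [M], for every e > 0. *)
Lemma span_opnorm_closed :
  opnorm_closed [set f : H -> H | exists c : I -> C, f = \sum_i c i *: (t i : H -> H)].
Proof.
move=> f _ fT.
have /choice[x /choice[y xy]] := dual_vectors.
pose c i := dot (f (x i)) (y i).
exists c; apply/funext => v; apply/eqP; rewrite -subr_eq0 -normr_eq0.
pose M := `|v| + \sum_i `|x i| * `|y i| * `|t i v|.
have le_eM (e : C) : 0 < e -> `|f v - (\sum_i c i *: (t i : H -> H)) v| <= e * M.
  move=> /fT[g [b ->] bg].
  rewrite -[f v](subrK ((\sum_i b i *: (t i : H -> H)) v)) -addrA.
  apply: le_trans (ler_normD _ _) _; rewrite mulrDr lerD //.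
  rewrite !fct_sumE -sumrB.
  apply: le_trans (ler_norm_sum _ _ _) _; rewrite mulr_sumr ler_sum // => i _.
  rewrite !fctE -scalerBl normrZ mulrA ler_wpM2r // mulrA.
  have -> : b i - c i = dot ((\sum_i b i *: (t i : H -> H)) (x i) - f (x i)) (y i).
    rewrite dotBl -/(c i) fct_sumE dot_suml (bigD1 i) //= big1 => [|j ji].
      by rewrite fctE dotZl xy eqxx mulr1 addr0.
    by rewrite fctE dotZl xy eq_sym (negPf ji) mulr0.
  apply: le_trans (cauchy_schwarz _ _) _; rewrite ler_wpM2r //.
  by rewrite distrC; exact: bg.
have M0 : 0 <= M by rewrite addr_ge0 // sumr_ge0 // => i _; rewrite !mulr_ge0.
apply/negP => /negP nz.
have pos : 0 < `|f v - (\sum_i c i *: (t i : H -> H)) v| by rewrite lt_def nz normr_ge0.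
set r := `|_| in pos le_eM.
(* The choice e = r / (M + 1) would give M + 1 <= M; the summand 1 covers [M = 0]. *)
have M1 : 0 < M + 1 by rewrite ltr_wpDl.
have := le_eM (r / (M + 1)); rewrite divr_gt0 // => /(_ isT).
rewrite mulrAC ler_pdivlMr // ler_pM2l //.
by rewrite gerDl ler10.
Qed.

End OrthogonalFamily.

(** * The universal TRO of a rectangular grid *)

Section SpanMx.
Variables (C : numClosedFieldType) (V : lmodType C) (n m : nat).
Variable t : 'I_n -> 'I_m -> V.

Definition span_mx (x : 'M[C]_(n, m)) : V := \sum_i \sum_j x i j *: t i j.

Fact span_mx_linear : linear span_mx.
Proof.
move=> l x y; rewrite /span_mx scaler_sumr -big_split; apply: eq_bigr => i _.
rewrite /= scaler_sumr -big_split; apply: eq_bigr => j _.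
by rewrite /= !mxE scalerDl scalerA.
Qed.
HB.instance Definition _ := GRing.isLinear.Build C _ _ _ span_mx span_mx_linear.

Lemma span_mx_delta i j : span_mx (delta_mx i j) = t i j.
Proof.
rewrite /span_mx (bigD1 i) //= (bigD1 j) //= mxE !eqxx scale1r.
rewrite !big1 ?addr0 // => [k ki|k kj]; last by rewrite mxE (negPf kj) andbF scale0r.
by rewrite big1 // => l _; rewrite mxE (negPf ki) scale0r.
Qed.

End SpanMx.

Lemma linear_on_zero (C : numClosedFieldType) (V W : lmodType C) (D : set V)
    (f : V -> W) :
  (forall l x y, D x -> D y -> f (l *: x + y) = l *: f x + f y) -> D 0 ->
  f 0 = 0.
Proof.
move=> fl D0; have /esym/eqP := fl 1 0 0 D0 D0.
by rewrite !scale1r addr0 -subr_eq0 addrK => /eqP.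
Qed.

Lemma linear_on_scale (C : numClosedFieldType) (V W : lmodType C) (D : set V)
    (f : V -> W) :
  (forall l x y, D x -> D y -> f (l *: x + y) = l *: f x + f y) -> D 0 ->
  forall l x, D x -> f (l *: x) = l *: f x.
Proof.
move=> fl D0 l x Dx.
by have := fl l x 0 Dx D0; rewrite (linear_on_zero fl D0) !addr0.
Qed.

(** * The grid axioms as relations of matrix units *)

Section JordanGrid.
Variables (R : realType) (A : cstarAlgebra R) (Z : set A) (n m : nat).
Variable u : 'I_n -> 'I_m -> A.
Hypothesis hu : rectangular_grid Z u.
Local Notation J := (jordan (@cstar_triple R A)).

Lemma jordanC (V : lmodType R[i]) (p : V -> V -> V -> V) x y z :
  jordan p x y z = jordan p z y x.
Proof. by rewrite /jordan addrC. Qed.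

Lemma cstar_triple_sesquitrilinear : sesquitrilinear (@cstar_triple R A).
Proof.
split=> l x y z w; rewrite /cstar_triple.
- by rewrite !linearPl.
- by rewrite cstar_adj_semilinear linearPr linearPl.
- by rewrite linearPr.
Qed.

(** The cases are the sixteen patterns of coincidence between neighbouring indices. RG4 settles the
    unlisted ones; the others are instances of the tripotent law and RG1 to RG3, some with outer
    arguments exchanged. *)
Lemma grid_jordan i j k l p q :
  J (u i j) (u k l) (u p q) =
  2^-1 *: (u i q *+ ((j == l) && (k == p)) + u p j *+ ((i == k) && (l == q))).
Proof.
have half (x : A) : 2^-1 *: (x + x) = x.
  by rewrite scalerDr -scalerDl -[2^-1]mul1r -splitr scale1r.
have unlisted a b c : ~ grid_listed a b c -> ~ grid_listed c b a ->
    J (u a.1 a.2) (u b.1 b.2) (u c.1 c.2) = 0 := @grid_RG4 _ _ _ _ _ _ hu a b c.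
have [<-|/eqP ik] := eqVneq i k; have [<-|/eqP jl] := eqVneq j l;
  (have [<-|/eqP kp] := eqVneq _ p); (have [<-|/eqP lq] := eqVneq _ q);
  rewrite /= ?mulr0n ?mulr1n ?addr0 ?add0r ?scaler0;
  try by [apply: (unlisted (_, _) (_, _) (_, _)) => -[[]|[/=]]; congruence].
- by have [_ [_ + _]] := grid_minimal hu i j; rewrite half.
- by have [] // := grid_RG2 hu (i := i) (j := i) (k := q) (l := j);
    left; split; congruence.
- by have [] // := grid_RG2 hu (i := i) (j := p) (k := j) (l := j);
    right; split; congruence.
- by apply: (grid_RG1 hu); congruence.
- rewrite jordanC.
  by have [] // := grid_RG2 hu (i := i) (j := i) (k := j) (l := l);
    left; split; congruence.
- by apply: (grid_RG3 hu); congruence.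
- rewrite jordanC.
  by have [] // := grid_RG2 hu (i := k) (j := i) (k := j) (l := j);
    right; split; congruence.
- by rewrite jordanC; apply: (grid_RG3 hu); congruence.
- by rewrite jordanC; apply: (grid_RG1 hu); congruence.
Qed.

Lemma span_grid_jordan x y z :
  J (span_mx u x) (span_mx u y) (span_mx u z) =
  span_mx u (jordan mx_triple x y z).
Proof.
apply: (@sesquitrilinear_ext _ _ _ _ _ _ (span_mx u)).
- exact/jordan_sesquitrilinear/cstar_triple_sesquitrilinear.
- exact/jordan_sesquitrilinear/mx_triple_sesquitrilinear.
move=> i j k l p q /=; rewrite !span_mx_delta grid_jordan /jordan !mx_triple_delta.
rewrite linearZ /= (raddfD (span_mx u)) /= !(raddfMn (span_mx u)) /= !span_mx_delta.
by rewrite [q == l]eq_sym [k == i]eq_sym [(l == q) && _]andbC.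
Qed.

(** The product {u_ij, x, u_ij} is the conjugate of the coefficient x_ij times u_ij, and u_ij is
    non-zero. *)
Lemma span_grid_inj : injective (span_mx u).
Proof.
apply: raddf_inj => x; move=> x0; apply/matrixP=> i j.
have := span_grid_jordan (delta_mx i j) x (delta_mx i j).
have -> : jordan mx_triple (delta_mx i j) x (delta_mx i j) =
    Num.conj (x i j) *: (delta_mx i j : 'M[R[i]]_(n, m)).
  by rewrite jordan_diag mx_triple_delta_diag.
rewrite x0 linearZ /= span_mx_delta.
have [_ -> _] := sesquitrilinear0
  (jordan_sesquitrilinear cstar_triple_sesquitrilinear) (u i j) (u i j).
move/esym/eqP; rewrite scaler_eq0 conjC_eq0 => /orP[/eqP ->|]; first by rewrite mxE.
by move/eqP; case: (grid_minimal hu i j).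
Qed.

End JordanGrid.

(** * Both sides of the grid have length at least 2 *)

Section GridSize.
Variables (R : realType) (A : cstarAlgebra R) (Z : set A) (n m : nat).
Variable u : 'I_n -> 'I_m -> A.
Hypothesis hu : rectangular_grid Z u.

Lemma grid_spansE : grid_spans Z u -> Z = range (span_mx u).
Proof.
rewrite /grid_spans => ->; apply/seteqP; split=> _ [c _ <-].
  exists (\matrix_(i, j) c i j) => //; apply: eq_bigr => i _.
  by apply: eq_bigr => j _; rewrite mxE.
by exists (fun i j => c i j).
Qed.

(** If a side has length 1, then x x^* or x^* x is a 1 by 1 matrix, hence a scalar; if a side has
    length 0, both matrices are empty. *)
Lemma mx_triple_rank1 (x : 'M[R[i]]_(n, m)) : (n <= 1)%N || (m <= 1)%N ->
  exists l, mx_triple x x x = l *: x.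
Proof.
have scal (y : 'M[R[i]]_1) : y = (y ord0 ord0)%:M by exact: mx11_scalar.
move=> nm; rewrite /mx_triple; set y := map_mx _ _.
case/orP: nm; rewrite leq_eqVlt ltnS leqn0 => /orP[] /eqP k1.
- subst n; exists ((x *m y) ord0 ord0).
  by rewrite (scal (x *m y)) mul_scalar_mx -scal.
- by exists 0; apply/matrixP=> -[i ilt]; exfalso; rewrite k1 in ilt.
- subst m; exists ((y *m x) ord0 ord0).
  by rewrite -mulmxA (scal (y *m x)) mul_mx_scalar -scal.
- by exists 0; apply/matrixP=> ? -[i ilt]; exfalso; rewrite k1 in ilt.
Qed.

Lemma grid_size_ge2 r : grid_spans Z u -> type_I_of_rank Z r -> (2 <= r)%N ->
  (2 <= n)%N /\ (2 <= m)%N.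
Proof.
move=> /grid_spansE ZE [p [q [-> [f [fZ fl fJ] [_ _ fS]]]]] hr.
apply/andP; apply: contraT; rewrite negb_and -!ltnNge !ltnS => nm.
have [i0 [i1 i01]] : exists i0 i1 : 'I_p, i0 != i1.
  have p2 : (2 <= p)%N := leq_trans hr (geq_minl _ _).
  by exists (Ordinal (ltnW p2)), (Ordinal p2).
have [j0 [j1 j01]] : exists j0 j1 : 'I_q, j0 != j1.
  have q2 : (2 <= q)%N := leq_trans hr (geq_minr _ _).
  by exists (Ordinal (ltnW q2)), (Ordinal q2).
(* The singular values 2 and 1 of [x] become 8 and 1 in its triple product, so no scalar [l] can
   serve both entries. *)
pose x : 'M[R[i]]_(p, q) := 2 *: delta_mx i1 j1 + delta_mx i0 j0.
have [l xl] : exists l, mx_triple x x x = l *: x.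
  have [z Zz <-] : (f @` Z) x by exact: fS.
  move: (Zz); rewrite {1}ZE => -[y _ yz].
  have [l yl] := mx_triple_rank1 y nm; exists l.
  rewrite -jordan_diag -fJ // -(linear_on_scale fl _ _ Zz); last first.
    by rewrite ZE; exists 0 => //; rewrite linear0.
  by rewrite -yz (span_grid_jordan hu) jordan_diag yl linearZ.
have x3 : mx_triple x x x = 8 *: delta_mx i1 j1 + delta_mx i0 j0.
  have [p1 p2 p3] := @mx_triple_sesquitrilinear R p q.
  rewrite /x !(p1, p2, p3) !mx_triple_delta !eqxx [i1 == i0]eq_sym.
  rewrite [j1 == j0]eq_sym (negPf i01) (negPf j01) /= !mulr0n !mulr1n.
  rewrite !(scaler0, addr0, add0r) conjC_nat !scalerA.
  by congr (_ *: _ + _); rewrite -!natrM.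
have e1 : l = 1.
  have := congr1 (fun y : 'M_(p, q) => y i0 j0) xl.
  by rewrite x3 !mxE !eqxx (negPf i01) /= !mulr0 !add0r mulr1.
have := congr1 (fun y : 'M_(p, q) => y i1 j1) xl.
rewrite x3 e1 !mxE !eqxx eq_sym (negPf i01) /= !addr0 !mulr1 mul1r.
by move/eqP; rewrite eqr_nat.
Qed.

End GridSize.

Section AdjointableSpan.
Variables (R : realType) (H : hilbertSpace R).
Let sI := adj_star_involution H.

Lemma adj_mul2I (f : adjointable H) : f + f = 0 -> f = 0.
Proof.
move=> f0; rewrite -[f]scale1r [1 in LHS]splitr mul1r scalerDl -scalerDr f0.
by rewrite scaler0.
Qed.

Lemma adj_star_span p q (t : 'I_p -> 'I_q -> adjointable H) x :
  adj_star (span_mx t x) =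
  span_mx (fun i j => adj_star (t i j)) (map_mx Num.conj x).
Proof.
have [_ sD _] := sI; move: x; apply: mx_linear_ind => [|l x y hx hy|i j].
- by rewrite map_mx0 !linear0 (star0 sI).
- by rewrite map_mxD map_mxZ !linearP /= sD adj_starZ hx hy.
- by rewrite map_delta_mx !span_mx_delta.
Qed.

Lemma span_mx_ortho n1 m1 n2 m2 (t1 : 'I_n1 -> 'I_m1 -> adjointable H)
    (t2 : 'I_n2 -> 'I_m2 -> adjointable H) :
  (forall i j k l, t1 i j * adj_star (t2 k l) = 0) ->
  forall x y, span_mx t1 x * adj_star (span_mx t2 y) = 0.
Proof.
move=> t12 x y; have [p1 p2 _] := @adj_triple_sesquitrilinear R H.
have p0 f := sesquitrilinear0 (@adj_triple_sesquitrilinear R H) f 1.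
(* A third factor 1 makes the sesquitrilinear rules available for f g^*. *)
have tE f g : f * adj_star g = adj_triple f g 1 by rewrite /adj_triple mulr1.
rewrite tE; move: x; apply: mx_linear_ind => [|l x x' hx hx'|i j].
- by rewrite linear0; case: (p0 (span_mx t2 y)).
- by rewrite linearP p1 hx hx' scaler0 addr0.
rewrite span_mx_delta; move: y; apply: mx_linear_ind => [|l y y' hy hy'|k l].
- by rewrite linear0; case: (p0 (t1 i j)).
- by rewrite linearP p2 hy hy' scaler0 addr0.
by rewrite span_mx_delta -tE t12.
Qed.

End AdjointableSpan.

(** * Determination of the universal TRO *)

Section UniversalTRO.
Variables (R : realType) (A : cstarAlgebra R) (Z : set A) (n m : nat).
Variable u : 'I_n.+2 -> 'I_m.+2 -> A.
Hypotheses (hu : rectangular_grid Z u) (hspan : grid_spans Z u).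
Variables (H : hilbertSpace R) (T : set (H -> H)) (rho : A -> (H -> H)).
Hypothesis hT : is_universal_TRO Z T rho.
Local Notation C := R[i].
Let sI := adj_star_involution H.

Let ZE : Z = range (span_mx u) := grid_spansE hspan.
Let Zu x : Z (span_mx u x). Proof. by rewrite ZE; exists x. Qed.
Let Zuij i j : Z (u i j). Proof. by rewrite -span_mx_delta. Qed.

Lemma rho_adjointable i j : exists g, is_adjoint (rho (u i j)) g.
Proof.
have [Tb _ _ _] := universal_TRO hT; have [TT _ rJ] := universal_hom hT.
have := rJ _ _ _ (Zuij i j) (Zuij i j) (Zuij i j).
have [_ [_ -> _]] := grid_minimal hu i j; rewrite jordan_diag.
rewrite /op_triple /adjoint; case: xgetP => [g _ fg _|_ f0]; first by exists g.
(* With the default adjoint 0, [f0] says that [rho (u i j)] is constantly its value at 0, which is 0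
   by linearity. *)
exists 0 => x y; rewrite f0 /=.
have [fl _] := Tb _ (TT _ (Zuij i j)).
have -> : rho (u i j) 0 = 0.
  by apply: (@linear_on_zero _ _ _ setT) => // *; exact: fl.
by rewrite linear0l linear0r.
Qed.

Definition grid_op i j : adjointable H := Adjointable (rho_adjointable i j).
Local Notation e := grid_op.

Lemma rho_span x : rho (span_mx u x) = span_mx e x.
Proof.
have [_ rl _] := universal_hom hT.
move: x; apply: mx_linear_ind => [|l x y hx hy|i j].
- rewrite !linear0; apply: (linear_on_zero rl).
  by rewrite -(linear0 (span_mx u)); exact: Zu.
- by rewrite !linearP /= rl // hx hy.
- by rewrite !span_mx_delta.
Qed.

Lemma grid_op_jordan : jordan_grid (@adj_star R H) e.
Proof.
move=> i j k l p q; have [_ _ rJ] := universal_hom hT.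
have := rJ _ _ _ (Zu (delta_mx i j)) (Zu (delta_mx k l)) (Zu (delta_mx p q)).
rewrite (span_grid_jordan hu) !rho_span !span_mx_delta => h.
have {h} : jordan (@adj_triple R H) (e i j) (e k l) (e p q) =
    span_mx e (jordan mx_triple (delta_mx i j) (delta_mx k l) (delta_mx p q)).
  by apply: adjointable_inj; rewrite h.
rewrite /jordan linearZ /= => /scalerI ->; last by rewrite invr_eq0 pnatr_eq0.
rewrite !mx_triple_delta (raddfD (span_mx e)) /= !(raddfMn (span_mx e)) /=.
by rewrite !span_mx_delta [q == l]eq_sym [k == i]eq_sym [(l == q) && _]andbC.
Qed.

Local Notation a := (grid_part (@adj_star R H) e).
Local Notation b := (grid_part (@adj_star R H) (fun j i => e i j)).

(** Coefficients with respect to the grid are unique, so [theta] induces a Jordan homomorphism on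
    [Z] with values in operators, to which the universal property applies. *)
Lemma factor_corner p q (theta : {linear 'M[C]_(n.+2, m.+2) -> 'M[C]_(p, q)}) :
  (forall x y z, theta (jordan mx_triple x y z) =
     jordan mx_triple (theta x) (theta y) (theta z)) ->
  exists2 phi : (H -> H) -> (l2_space R (p + q) -> l2_space R (p + q)),
    triple_hom op_triple T op_triple bounded_operator phi &
    forall x, phi (rho (span_mx u x)) = corner (theta x).
Proof.
move=> thetaJ.
pose coef (z : A) := xget 0 [set x | span_mx u x = z].
have coefK x : coef (span_mx u x) = x.
  rewrite /coef; case: xgetP => [y _ /(span_grid_inj hu)//|/(_ x)].
  by case.
have [|phi phiT phiE] := universal_factor hT (alpha := fun z => corner (theta (coef z)))
    (@l2_bounded_TRO R (p + q)).
  split=> [z _|l x y|x y z]; first exact: mx_op_bounded.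
    rewrite ZE => -[x' _ <-] [y' _ <-].
    by rewrite -linearP !coefK linearP corner_linear.
  rewrite ZE => -[x' _ <-] [y' _ <-] [z' _ <-].
  rewrite (span_grid_jordan hu) !coefK thetaJ /jordan !corner_triple.
  by rewrite linearZ linearD.
by exists phi => // x; rewrite -phiE // coefK.
Qed.

Let eT i j : T (e i j).
Proof. by have [TT _ _] := universal_hom hT; exact: TT. Qed.

Let op_tripleT f g h : T f -> T g -> T h -> T (op_triple f g h).
Proof. by have [_ _ _ TJ] := universal_TRO hT; exact: TJ. Qed.

Lemma partT i j : T (a i j) /\ T (b j i).
Proof. by split; exact: (op_tripleT (eT _ _) (eT _ _) (eT _ _)). Qed.

Lemma part_neq0 i j : a i j != 0 /\ b j i != 0.
Proof.
have delta_neq0 k l (i' : 'I_k) (j' : 'I_l) : delta_mx i' j' != 0 :> 'M[C]_(k, l).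
  apply/negP => /eqP/matrixP/(_ i' j')/eqP.
  by rewrite !mxE !eqxx oner_eq0.
have [_ [T0 _] _ _] := universal_TRO hT.
split; apply/eqP => p0.
  (* [phi] sends the three factors of [a i j] to matrix units with product E_ij, so it cannot send
     [a i j] to 0. *)
  have [//|phi [_ phil phiM] phiE] := factor_corner (theta := idfun).
  have := phiM _ _ _ (eT i (other j)) (eT (other i) (other j)) (eT (other i) j).
  rewrite -adj_tripleE [adj_triple _ _ _]p0 (linear_on_zero phil) //=.
  rewrite -!(span_mx_delta u) !phiE corner_triple mx_triple_delta !eqxx.
  by move/esym/corner_eq0/eqP; rewrite (negPf (delta_neq0 _ _ _ _)).
(* Transposition reverses products, which only swaps the two terms of the Jordan product. *)
have trJ x y z : (jordan mx_triple x y z)^T =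
   jordan mx_triple x^T y^T z^T :> 'M[C]_(m.+2, n.+2).
  rewrite /jordan linearZ linearD /= addrC /mx_triple.
  by rewrite !trmx_mul -!map_trmx !trmxK !mulmxA.
have [//|phi [_ phil phiM] phiE] := factor_corner (theta := trmx).
have := phiM _ _ _ (eT (other i) j) (eT (other i) (other j)) (eT i (other j)).
rewrite -adj_tripleE [adj_triple _ _ _]p0 (linear_on_zero phil) //=.
rewrite -!(span_mx_delta u) !phiE /= !trmx_delta corner_triple mx_triple_delta !eqxx.
by move/esym/corner_eq0/eqP; rewrite (negPf (delta_neq0 _ _ _ _)).
Qed.

Let parts_product := grid_parts_product sI (@adj_mul2I R H) grid_op_jordan.

Lemma span_part_triple :
  (forall x y z, adj_triple (span_mx a x) (span_mx a y) (span_mx a z) =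
     span_mx a (mx_triple x y z)) /\
  (forall x y z, adj_triple (span_mx b x) (span_mx b y) (span_mx b z) =
     span_mx b (mx_triple x y z)).
Proof.
split; apply: sesquitrilinear_ext; try exact: adj_triple_sesquitrilinear;
  try exact: mx_triple_sesquitrilinear; move=> i j k l p q /=;
  rewrite mx_triple_delta raddfMn /= !span_mx_delta.
  by case: (parts_product i j k l p q).
by case: (parts_product j i l k q p) => _; rewrite andbC eq_sym.
Qed.

(** This is the inverse of the isomorphism to be constructed. *)
Definition assemble (w : 'M[C]_(n.+2, m.+2) * 'M[C]_(m.+2, n.+2)) : adjointable H :=
  span_mx a w.1 + span_mx b w.2.

Fact assemble_linear : linear assemble.
Proof. by move=> l x y; rewrite /assemble !linearP scalerDr addrACA. Qed.
HB.instance Definition _ := GRing.isLinear.Build C _ _ _ assemble assemble_linear.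

Lemma assemble_triple w w' w'' :
  adj_triple (assemble w) (assemble w') (assemble w'') =
  assemble (mx2_triple w w' w'').
Proof.
have [sK sD sM] := sI; have [aJ bJ] := span_part_triple.
have ab x y : span_mx a x * adj_star (span_mx b y) = 0.
  by apply: span_mx_ortho => *; exact: (grid_part_star_tr sI (@adj_mul2I R H) grid_op_jordan).
have ba x y : span_mx b y * adj_star (span_mx a x) = 0.
  by rewrite -[LHS]sK sM sK ab (star0 sI).
have a'b x y : adj_star (span_mx a x) * span_mx b y = 0.
  (* Passing to the adjoint families brings a^* b into the form x y^* of [span_mx_ortho]. *)
  rewrite -[span_mx b y]sK (adj_star_span a) (adj_star_span b).
  apply: span_mx_ortho => i j k l; rewrite sK.
  exact: (grid_star_part_tr sI (@adj_mul2I R H) grid_op_jordan).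
have b'a x y : adj_star (span_mx b y) * span_mx a x = 0.
  by rewrite -[LHS]sK sM sK a'b (star0 sI).
rewrite /assemble /= -aJ -bJ /adj_triple sD.
rewrite [X in X * _](_ : _ = span_mx a w.1 * adj_star (span_mx a w'.1) +
    span_mx b w.2 * adj_star (span_mx b w'.2)); last first.
  by rewrite mulrDl !mulrDr ab ba addr0 add0r.
rewrite mulrDl !mulrDr -(mulrA (span_mx a _) _ (span_mx b w''.2)) a'b mulr0 addr0.
by rewrite -(mulrA (span_mx b _) _ (span_mx a w''.1)) b'a mulr0 add0r.
Qed.

Lemma assemble_inj : injective assemble.
Proof.
apply: raddf_inj => w w0.
(* For [v] a matrix unit in one summand, this is a conjugated entry of [w] times a non-zero part. *)
have h v : assemble (mx2_triple v w v) = 0.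
  rewrite -assemble_triple w0.
  by have [] := sesquitrilinear0 (@adj_triple_sesquitrilinear R H)
    (assemble v) (assemble v).
case: w {w0} h => x y h; congr pair; apply/matrixP=> i j; rewrite mxE; apply/eqP.
  have := h (delta_mx i j, 0).
  rewrite /mx2_triple /= mx_triple_delta_diag mx_triple_0m /assemble /=.
  rewrite linear0 addr0 linearZ /= span_mx_delta => /eqP.
  rewrite scaler_eq0 conjC_eq0 => /orP[//|].
  by case: (part_neq0 i j) => /negPf ->.
have := h (0, delta_mx i j).
rewrite /mx2_triple /= mx_triple_delta_diag mx_triple_0m /assemble /=.
rewrite linear0 add0r linearZ /= span_mx_delta => /eqP.
rewrite scaler_eq0 conjC_eq0 => /orP[//|].
by case: (part_neq0 j i) => _ /negPf ->.
Qed.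

Let assembleT w : T (assemble w).
Proof.
have [_ [T0 Tl] _ _] := universal_TRO hT.
have TD f g : T f -> T g -> T (f + g).
  by move=> Tf Tg; rewrite -[f]scale1r; exact: Tl.
apply: (TD (adj_op (span_mx a w.1)) (adj_op (span_mx b w.2))).
  move: w.1; apply: mx_linear_ind => [|l x y hx hy|i j].
  - by rewrite linear0.
  - by rewrite linearP; exact: Tl.
  - by rewrite span_mx_delta; case: (partT i j).
move: w.2; apply: mx_linear_ind => [|l x y hx hy|i j].
- by rewrite linear0.
- by rewrite linearP; exact: Tl.
- by rewrite span_mx_delta; case: (partT j i).
Qed.

(** Both systems are joined into one orthogonal family over a finite type, as the closedness
    argument requires. *)
Definition parts (k : 'I_n.+2 * 'I_m.+2 + 'I_m.+2 * 'I_n.+2) : adjointable H :=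
  match k with inl ij => a ij.1 ij.2 | inr ji => b ji.1 ji.2 end.

Lemma parts_ortho k l :
  parts k * adj_star (parts l) * parts k = parts k *+ (k == l).
Proof.
case: k l => [[i j]|[j i]] [[k l]|[l k]] /=.
- by have [-> _] := parts_product i j k l i j; rewrite andbC [k == i]eq_sym.
- by rewrite (grid_part_star_tr sI (@adj_mul2I R H) grid_op_jordan) mul0r.
- by rewrite (grid_part_tr_star sI (@adj_mul2I R H) grid_op_jordan) mul0r.
- by have [_ ->] := parts_product i j k l i j; rewrite andbC [l == j]eq_sym.
Qed.

Lemma assemble_parts c : assemble (\matrix_(i, j) c (inl (i, j)),
    \matrix_(j, i) c (inr (j, i))) = \sum_k c k *: parts k.
Proof.
rewrite big_sumType /assemble /span_mx !pair_bigA /=.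
by congr (_ + _); apply: eq_bigr => -[i j] _; rewrite mxE.
Qed.

Lemma range_assembleE : range (fun w => assemble w : H -> H) =
  [set f | exists c, f = \sum_k c k *: (parts k : H -> H)].
Proof.
have sumE c : \sum_k c k *: (parts k : H -> H) = adj_op (\sum_k c k *: parts k).
  by symmetry; exact: (big_morph (@adj_op R H)).
apply/seteqP; split=> [_ [[x y] _ <-]|_ [c ->]]; last first.
  by rewrite sumE -assemble_parts; eexists.
exists (fun k => match k with inl ij => x ij.1 ij.2 | inr ji => y ji.1 ji.2 end).
rewrite sumE -assemble_parts; congr (adj_op (assemble (_, _)));
  by apply/matrixP => i j; rewrite mxE.
Qed.

Lemma assemble_range : T = range (fun w => assemble w : H -> H).
Proof.
apply/seteqP; split; last by move=> _ [w _ <-]; exact: assembleT.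
have [Tb _ _ _] := universal_TRO hT.
rewrite (universal_generated hT); apply: smallest_sub.
  split.
  - by move=> _ [w _ <-]; apply: Tb.
  - split; first by exists 0 => //; rewrite linear0.
    move=> l _ _ [w _ <-] [w' _ <-]; exists (l *: w + w') => //.
    by rewrite linearP.
  - rewrite range_assembleE; apply: span_opnorm_closed => [|k].
      exact: parts_ortho.
    by case: k => [[i j]|[j i]] /=; case: (part_neq0 i j).
  - move=> _ _ _ [w _ <-] [w' _ <-] [w'' _ <-].
    by exists (mx2_triple w w' w'') => //; rewrite -assemble_triple.
move=> _ [z + <-]; rewrite ZE => -[x _ <-].
(* The second component is transposed because e_ij = [a i j] + [b j i]. *)
exists (x, x^T) => //; rewrite rho_span; congr adj_op.
rewrite /assemble /=.
move: x; apply: mx_linear_ind => [|l x y hx hy|i j].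
- by rewrite trmx0 !linear0 addr0.
- by rewrite linearP !linearP /= -hx -hy scalerDr addrACA.
- by rewrite trmx_delta !span_mx_delta -(grid_split grid_op_jordan).
Qed.

Theorem universal_TRO_iso :
  triple_isomorphic op_triple T mx2_triple
    [set: 'M[C]_(n.+2, m.+2) * 'M[C]_(m.+2, n.+2)].
Proof.
(* [f] inverts [assemble] on its range, which is all of [T]; off [T] the default 0 is immaterial. *)
pose f (h : H -> H) := xget 0 [set w | assemble w = h :> (H -> H)].
have fK w : f (assemble w) = w.
  rewrite /f; case: xgetP => [w' _ /adjointable_inj/assemble_inj//|/(_ w)].
  by case.
exists f; last split=> //.
- split=> // [l x y|x y z]; rewrite {1 2}assemble_range => -[w _ <-] [w' _ <-].
    have := fK (l *: w + w'); rewrite linearP !fK => <-//.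
  rewrite assemble_range => -[w'' _ <-].
  by rewrite -adj_tripleE assemble_triple !fK.
- move=> x y; rewrite !inE assemble_range => -[w _ <-] [w' _ <-].
  by rewrite !fK => ->.
- move=> w _; exists (adj_op (assemble w)); last exact: fK.
  by rewrite assemble_range; exists w.
Qed.

End UniversalTRO.

Theorem theorem3p13 (R : realType) (A : cstarAlgebra R) (Z : set A)
    (r n m : nat) (u : 'I_n -> 'I_m -> A)
    (hZ : is_JCstar Z) (hI : type_I_of_rank Z r) (hr : (2 <= r)%N)
    (hu : rectangular_grid Z u) (hspan : grid_spans Z u)
    (H : hilbertSpace R) (T : set (H -> H)) (rho : A -> (H -> H))
    (hT : is_universal_TRO Z T rho) :
  triple_isomorphic op_triple T
    mx2_triple [set: 'M[R[i]]_(n, m) * 'M[R[i]]_(m, n)].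
Proof.
have [n2 m2] := grid_size_ge2 hu hspan hI hr.
case: n n2 u hu hspan => [|[|n]] // _; case: m m2 => [|[|m]] // _ u hu hspan.
exact: (universal_TRO_iso hu hspan hT).
Qed.
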